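(* Starting with an empty graph on $n$ vertices, under any sequence of edge insertions and deletions, a proper $(\Delta+1)$-coloring can be maintained deterministically, performing at most one recoloring per update, with worst-case $O(\sqrt{m})$ update time and worst-case $O(1)$ query time, where $\Delta$ is the maximum degree of a vertex and $m$ is the maximum number of edges in the graph at any point during the update sequence.
   Context: A proper $c$-coloring assigns each vertex a color in $\{1,\dots,c\}$ such that adjacent vertices receive different colors; the coloring is stored explicitly and a query returns the color of a given vertex. A recoloring is a change of the color of one vertex during an update. *)

(* Defs.v *)
From Stdlib Require Import Rdefinitions Raxioms R_sqrt.
From mathcomp Require Import all_boot.

Set Implicit Arguments.
Unset Strict Implicit.
Unset Printing Implicit Defensive.

(** Programs are written in a structured language over a unit-cost RAM.  Every
    value a program computes has to be a word, i.e. smaller than a bound [W]: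
    a computation that overflows has no execution at all. *)

Inductive binop := Add | Sub | Mul | Div | Mod | Lt | Eq.

Definition eval_binop (o : binop) (x y : nat) : nat :=
  match o with
  | Add => x + y
  | Sub => x - y
  | Mul => x * y
  | Div => x %/ y
  | Mod => x %% y
  | Lt => x < y
  | Eq => x == y
  end.

Inductive expr :=
| Const of nat
| Reg of nat
| Mem of expr
| Col of expr
| Bin of binop & expr & expr.

Inductive cmd :=
| Skip
| SetReg of nat & expr
| SetMem of expr & expr
| SetCol of expr & expr
| Seq of cmd & cmd
| If of expr & cmd & cmd
| While of expr & cmd.

(** The coloring is stored explicitly, in the dedicated array [col]: this is what
    makes recolorings countable in [exec]. *)
Record state := State {
  reg : nat -> nat;
  mem : nat -> nat;
  col : nat -> nat }.

Definition upd (f : nat -> nat) (a x : nat) : nat -> nat :=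
  fun b => if b == a then x else f b.

Definition set_reg (s : state) (a x : nat) : state :=
  State (upd (reg s) a x) (mem s) (col s).
Definition set_mem (s : state) (a x : nat) : state :=
  State (reg s) (upd (mem s) a x) (col s).
Definition set_col (s : state) (a x : nat) : state :=
  State (reg s) (mem s) (upd (col s) a x).

Definition word (W x : nat) : option nat := if x < W then Some x else None.

Fixpoint eval (W : nat) (s : state) (e : expr) : option nat :=
  match e with
  | Const x => word W x
  | Reg a => Some (reg s a)
  | Mem e1 => if eval W s e1 is Some a then Some (mem s a) else None
  | Col e1 => if eval W s e1 is Some a then Some (col s a) else None
  | Bin o e1 e2 =>
      if eval W s e1 is Some x then
        if eval W s e2 is Some y then word W (eval_binop o x y) else None
      else None
  end.

Fixpoint cost (e : expr) : nat :=
  match e with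
  | Const _ | Reg _ => 1
  | Mem e1 | Col e1 => (cost e1).+1
  | Bin _ e1 e2 => (cost e1 + cost e2).+1
  end.

(** [exec W c s s' t r]: started in [s], the program [c] halts in [s'] after [t]
    time units, and during the execution the stored color of a vertex has been
    changed [r] times. *)
Inductive exec (W : nat) : cmd -> state -> state -> nat -> nat -> Prop :=
| ExecSkip s :
    exec W Skip s s 1 0
| ExecSetReg a e s x :
    eval W s e = Some x ->
    exec W (SetReg a e) s (set_reg s a x) (cost e).+1 0
| ExecSetMem e1 e2 s a x :
    eval W s e1 = Some a -> eval W s e2 = Some x ->
    exec W (SetMem e1 e2) s (set_mem s a x) (cost e1 + cost e2).+1 0
| ExecSetCol e1 e2 s v x :
    eval W s e1 = Some v -> eval W s e2 = Some x ->
    exec W (SetCol e1 e2) s (set_col s v x) (cost e1 + cost e2).+1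
         (x != col s v)
| ExecSeq c1 c2 s1 s2 s3 t1 t2 r1 r2 :
    exec W c1 s1 s2 t1 r1 -> exec W c2 s2 s3 t2 r2 ->
    exec W (Seq c1 c2) s1 s3 (t1 + t2) (r1 + r2)
| ExecIf e c1 c2 s s' x t r :
    eval W s e = Some x ->
    exec W (if x != 0 then c1 else c2) s s' t r ->
    exec W (If e c1 c2) s s' ((cost e).+1 + t) r
| ExecWhileStop e c s :
    eval W s e = Some 0 ->
    exec W (While e c) s s (cost e).+1 0
| ExecWhileStep e c s1 s2 s3 x t1 t2 r1 r2 :
    eval W s1 e = Some x -> x != 0 ->
    exec W c s1 s2 t1 r1 -> exec W (While e c) s2 s3 t2 r2 ->
    exec W (While e c) s1 s3 ((cost e).+1 + t1 + t2) (r1 + r2).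

Lemma exec_deterministic W c s s1 s2 t1 t2 r1 r2 :
  exec W c s s1 t1 r1 -> exec W c s s2 t2 r2 ->
  [/\ s1 = s2, t1 = t2 & r1 = r2].
Proof.
move=> H1; elim: H1 s2 t2 r2 => {c s s1 t1 r1};
  intros; match goal with H : exec W _ _ _ _ _ |- _ =>
    match goal with |- [/\ _ = ?z, _ & _] =>
      match type of H with exec _ _ _ z _ _ => inversion H; subst; clear H end
    end end;
  repeat match goal with
  | E1 : eval W ?s ?e = Some _, E2 : eval W ?s ?e = Some _ |- _ =>
      rewrite E1 in E2; case: E2 => ?; subst
  | IH : (forall s2 t2 r2, exec W ?c ?s s2 t2 r2 -> _), H : exec W ?c ?s _ _ _
      |- _ => have [? ? ?] := IH _ _ _ H; subst; clear H
  end; by [].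
Qed.

(** A graph on ['I_n] is its set of edges; [valid_op] below ensures that only
    2-element sets occur as edges. *)
Definition graph (n : nat) := {set {set 'I_n}}.

Definition adj (n : nat) (G : graph n) (u v : 'I_n) : bool :=
  [set u; v] \in G.

Definition degree (n : nat) (G : graph n) (v : 'I_n) : nat :=
  #|[set w | adj G v w]|.

Inductive op (n : nat) :=
| Insert of 'I_n & 'I_n
| Delete of 'I_n & 'I_n
| Query of 'I_n.

Definition valid_op (n : nat) (G : graph n) (o : op n) : bool :=
  match o with
  | Insert u v => (u != v) && ~~ adj G u v
  | Delete u v => adj G u v
  | Query _ => true
  end.

Definition apply_op (n : nat) (G : graph n) (o : op n) : graph n :=
  match o with
  | Insert u v => [set u; v] |: G
  | Delete u v => G :\ [set u; v]
  | Query _ => G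
  end.

Fixpoint valid_ops (n : nat) (G : graph n) (os : seq (op n)) : bool :=
  if os is o :: os' then valid_op G o && valid_ops (apply_op G o) os' else true.

Definition graphs (n : nat) (os : seq (op n)) : seq (graph n) :=
  set0 :: scanl (@apply_op n) set0 os.

Definition max_edges (n : nat) (os : seq (op n)) : nat :=
  \max_(G <- graphs os) #|G|.

Definition max_degree (n : nat) (os : seq (op n)) : nat :=
  \max_(G <- graphs os) \max_(v : 'I_n) degree G v.

Definition proper_coloring (n : nat) (G : graph n) (c : nat)
    (f : 'I_n -> nat) : Prop :=
  (forall v, 1 <= f v <= c) /\ (forall u v, adj G u v -> f u <> f v).

Record algorithm := Algorithm {
  insert_prog : cmd;
  delete_prog : cmd;
  query_prog : cmd }.

(** Register 0 holds [n] initially.  The memory is zeroed, and all vertices carry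
    the only color that a 1-coloring of the empty graph can use. *)
Definition init_state (n : nat) : state :=
  State (upd (fun=> 0) 0 n) (fun=> 0) (fun=> 1).

(** Operands are passed in registers 1 and 2; a query answers in register 3. *)
Definition load_op (n : nat) (s : state) (o : op n) : state :=
  match o with
  | Insert u v | Delete u v => set_reg (set_reg s 1 u) 2 v
  | Query v => set_reg s 1 v
  end.

Definition answer (s : state) : nat := reg s 3.

Definition prog (n : nat) (A : algorithm) (o : op n) : cmd :=
  match o with
  | Insert _ _ => insert_prog A
  | Delete _ _ => delete_prog A
  | Query _ => query_prog A
  end.

Definition op_spec (n : nat) (o : op n) (tu tq : R) (s' : state) (t r : nat)
    : Prop :=
  match o with
  | Insert _ _ | Delete _ _ => Rle (INR t) tu /\ r <= 1
  | Query v => [/\ Rle (INR t) tq, r = 0 & answer s' = col s' v]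
  end.

(** From the state [s], which represents the graph [G], the algorithm [A] (on
    words smaller than [W]) processes [os] such that the stored coloring is a
    proper [c]-coloring at the start and after each operation; every update
    takes time at most [tu] and every query time at most [tq]. *)
Fixpoint maintains (n : nat) (A : algorithm) (W c : nat) (tu tq : R)
    (s : state) (G : graph n) (os : seq (op n)) : Prop :=
  proper_coloring G c (fun v : 'I_n => col s v) /\
  match os with
  | [::] => True
  | o :: os' =>
      exists (s' : state) (t r : nat),
        [/\ exec W (prog A o) (load_op s o) s' t r,
            op_spec o tu tq s' t r
          & maintains A W c tu tq s' (apply_op G o) os']
  end.

(* Main.v *)
(** The edges at each vertex are kept in an array together with a table of positions.
    A parameter [K = Theta (sqrt m)] is doubled whenever the number of edges exceeds
    [K ^ 2], and a set [S] of vertices is maintained that contains all vertices whose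
    color is larger than [K].

    When an inserted edge joins two vertices of equal color, one of them, [u], is
    recolored: if [deg u <= K + |S|], all its neighbors are scanned for a free color in
    [1 .. deg u + 1]; otherwise a color in [K + 1 .. K + 1 + |S|] that no vertex of [S]
    has is free for [u], and it is at most [deg u].  If the new color exceeds [K],
    then [u], whose degree is then at least [K], enters [S].

    A deletion looks for one vertex of [S] of degree less than [K - 1], gives it a color
    less than [K] and removes it from [S].  A single deletion can bring two vertices of
    [S] below the threshold, but repairs only one.  This is compensated by counting the
    vertices of [S] of degree less than [K - 1] twice and those of degree [K - 1] once:
    the total is not increased by a deletion that repairs a vertex, and it is at most
    the number of vertices of degree at least [K - 1], hence [O (K)], after one that
    finds nothing to repair.  So [|S| = O (K)], and every update takes time [O (K)]. *)

From Stdlib Require Import Rdefinitions Raxioms RIneq R_sqrt FunctionalExtensionality.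
From mathcomp Require Import all_boot zify.
Require Import Defs.

Set Implicit Arguments.
Unset Strict Implicit.
Unset Printing Implicit Defensive.

(** * Weakest preconditions with cost *)

Fixpoint value (s : state) (e : expr) : nat :=
  match e with
  | Const x => x
  | Reg a => reg s a
  | Mem e1 => mem s (value s e1)
  | Col e1 => col s (value s e1)
  | Bin o e1 e2 => eval_binop o (value s e1) (value s e2)
  end.

(** Evaluation is split into the total function [value] and this absence of overflow, so that side
    conditions become arithmetic goals. *)
Fixpoint fits (W : nat) (s : state) (e : expr) : Prop :=
  match e with
  | Const x => x < W
  | Reg _ => True
  | Mem e1 | Col e1 => fits W s e1
  | Bin o e1 e2 =>
      [/\ fits W s e1, fits W s e2 & eval_binop o (value s e1) (value s e2) < W]
  end.

Lemma eval_fits W s e : fits W s e -> eval W s e = Some (value s e).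
Proof.
elim: e => [x|a|e IH|e IH|o e1 IH1 e2 IH2] //=.
- by rewrite /word => ->.
- by move=> /IH ->.
- by move=> /IH ->.
- by case=> /IH1 -> /IH2 ->; rewrite /word => ->.
Qed.

(** Total correctness: termination without overflow is part of the claim. As execution is
    deterministic, the run asserted to exist is the only one. *)
Definition wp W c s (Q : state -> nat -> nat -> Prop) : Prop :=
  exists s' t r, exec W c s s' t r /\ Q s' t r.

Section Wp.
Variable W : nat.
Implicit Types (s : state) (Q : state -> nat -> nat -> Prop).

Lemma wp_mono c s Q Q' :
  wp W c s Q -> (forall s' t r, Q s' t r -> Q' s' t r) -> wp W c s Q'.
Proof. by case=> s' [t [r [E HQ]]] H; exists s', t, r; split=> //; apply: H. Qed.

Lemma wp_skip s Q : Q s 1 0 -> wp W Skip s Q.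
Proof. by move=> H; exists s, 1, 0; split=> //; constructor. Qed.

Lemma wp_reg a e s Q : fits W s e ->
  Q (set_reg s a (value s e)) (cost e).+1 0 -> wp W (SetReg a e) s Q.
Proof.
by move=> /eval_fits E H; do 3! eexists; split; [apply: ExecSetReg E|exact: H].
Qed.

Lemma wp_mem e1 e2 s Q : fits W s e1 -> fits W s e2 ->
  Q (set_mem s (value s e1) (value s e2)) (cost e1 + cost e2).+1 0 ->
  wp W (SetMem e1 e2) s Q.
Proof.
move=> /eval_fits E1 /eval_fits E2 H.
by do 3! eexists; split; [apply: ExecSetMem E1 E2|exact: H].
Qed.

Lemma wp_col e1 e2 s Q : fits W s e1 -> fits W s e2 ->
  Q (set_col s (value s e1) (value s e2)) (cost e1 + cost e2).+1
    (value s e2 != col s (value s e1)) ->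
  wp W (SetCol e1 e2) s Q.
Proof.
move=> /eval_fits E1 /eval_fits E2 H.
by do 3! eexists; split; [apply: ExecSetCol E1 E2|exact: H].
Qed.

Lemma wp_seq c1 c2 s Q :
  wp W c1 s (fun s1 t1 r1 =>
    wp W c2 s1 (fun s2 t2 r2 => Q s2 (t1 + t2) (r1 + r2))) ->
  wp W (Seq c1 c2) s Q.
Proof.
case=> s1 [t1 [r1 [E1 [s2 [t2 [r2 [E2 H]]]]]]].
by do 3! eexists; split; [apply: ExecSeq E1 E2|exact: H].
Qed.

Lemma wp_if e c1 c2 s Q : fits W s e ->
  wp W (if value s e != 0 then c1 else c2) s
    (fun s' t r => Q s' ((cost e).+1 + t) r) ->
  wp W (If e c1 c2) s Q.
Proof.
move=> /eval_fits E [s' [t [r [X H]]]].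
by do 3! eexists; split; [apply: ExecIf E X|exact: H].
Qed.

(** Induction on the number of remaining iterations. [N] is the exact number of iterations, [I j]
    the invariant after [j] of them, and [T] bounds the time of the body. The loops of the algorithm
    never recolor, hence [r = 0]. *)
Lemma wp_while e c N T (I : nat -> state -> Prop) s Q :
  I 0 s ->
  (forall j s1, j < N -> I j s1 ->
     [/\ fits W s1 e, value s1 e != 0
       & wp W c s1 (fun s2 t r => [/\ I j.+1 s2, t <= T & r = 0])]) ->
  (forall s1, I N s1 -> fits W s1 e /\ value s1 e = 0) ->
  (forall s1 t, I N s1 -> t <= N * (T + (cost e).+1) + (cost e).+1 -> Q s1 t 0) ->
  wp W (While e c) s Q.
Proof.
move=> H0 Hs Hend HQ.
suff H d : forall j s1, I j s1 -> N - j = d -> j <= N ->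
    wp W (While e c) s1 (fun s2 t r =>
      [/\ I N s2, t <= d * (T + (cost e).+1) + (cost e).+1 & r = 0]).
  apply: (wp_mono (H _ 0 s H0 (subn0 _) (leq0n _))) => s1 t r [h1 h2 ->].
  exact: HQ.
elim: d => [|d IH] j {H0}s Hj Ed le.
  have {Hj Ed le} Hj : I N s by have -> : N = j by lia.
  have [/eval_fits Hf Hv] := Hend _ Hj.
  exists s, (cost e).+1, 0; split=> //; apply: ExecWhileStop; by rewrite Hf Hv.
have [|/eval_fits Hf Hv [s1 [t1 [r1 [X [I1 tT r0]]]]]] := Hs j s _ Hj; first lia.
have [||s2 [t2 [r2 [X2 [I2 tT2 r20]]]]] := IH _ _ I1; [lia..|].
exists s2, ((cost e).+1 + t1 + t2), (r1 + r2); split.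
  exact: ExecWhileStep Hf Hv X X2.
by split=> //; [nia|lia].
Qed.

End Wp.

(** * Rows *)

(* Rows [0 .. n - 1] hold the neighborhoods and row [n] holds the set [S].  The sizes of
   the rows, the color marks, the entries and the positions are interleaved at the
   addresses congruent to 0, 1, 2 and 3 modulo 4.  Positions are shifted by one, so that
   0 means absence, in accordance with the zeroed initial memory. *)
Definition eDeg e := Bin Mul (Const 4) e.
Definition eMark e := Bin Add (Bin Mul (Const 4) e) (Const 1).
Definition eNb e1 e2 :=
  Bin Add (Bin Mul (Const 4) (Bin Add (Bin Mul e1 (Reg 0)) e2)) (Const 2).
Definition ePos e1 e2 :=
  Bin Add (Bin Mul (Const 4) (Bin Add (Bin Mul e1 (Reg 0)) e2)) (Const 3).

Definition deg_of (m : nat -> nat) x := m (4 * x).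
Definition mark_of (m : nat -> nat) c := m (4 * c + 1).
Definition nb_of n (m : nat -> nat) x i := m (4 * (x * n + i) + 2).
Definition pos_of n (m : nat -> nat) x w := m (4 * (x * n + w) + 3).

(** A sparse set: the entries and the shifted positions invert each other, which gives membership
    test, insertion and removal in constant time. *)
Definition row_ok n m x : Prop :=
  (forall i, i < deg_of m x ->
     nb_of n m x i < n /\ pos_of n m x (nb_of n m x i) = i.+1) /\
  (forall w, w < n -> pos_of n m x w != 0 ->
     pos_of n m x w <= deg_of m x /\ nb_of n m x (pos_of n m x w).-1 = w).

Definition rows_ok n m : Prop :=
  (forall c, mark_of m c = 0) /\ (forall x, x <= n -> row_ok n m x).

Lemma cell_inj n x y i j : i < n -> j < n ->
  (x * n + i == y * n + j) = (x == y) && (i == j).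
Proof.
move=> Hi Hj; apply/eqP/andP => [E|[/eqP -> /eqP ->] //].
have n0 : 0 < n by lia.
have : (x * n + i) %/ n = (y * n + j) %/ n by rewrite E.
rewrite !divnMDl // !divn_small // !addn0 => Exy.
by rewrite Exy in E *; rewrite eqxx; split=> //; apply/eqP; lia.
Qed.

Section Views.
Variables (n : nat) (m : nat -> nat).
Implicit Types x y i j v w c : nat.

Let E k k' x y : k < 4 -> k' < 4 ->
  (4 * x + k == 4 * y + k') = (k == k') && (x == y).
Proof. by lia. Qed.

Lemma deg_deg x v y :
  deg_of (upd m (4 * x) v) y = if y == x then v else deg_of m y.
Proof. by rewrite /deg_of /upd; have -> : (4 * y == 4 * x) = (y == x) by lia. Qed.
Lemma deg_nb a v y : deg_of (upd m (4 * a + 2) v) y = deg_of m y.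
Proof. by rewrite /deg_of /upd; case: eqP => //; lia. Qed.
Lemma deg_pos a v y : deg_of (upd m (4 * a + 3) v) y = deg_of m y.
Proof. by rewrite /deg_of /upd; case: eqP => //; lia. Qed.

Lemma mark_deg x v y : mark_of (upd m (4 * x) v) y = mark_of m y.
Proof. by rewrite /mark_of /upd; case: eqP => //; lia. Qed.
Lemma mark_nb a v y : mark_of (upd m (4 * a + 2) v) y = mark_of m y.
Proof. by rewrite /mark_of /upd; case: eqP => //; lia. Qed.
Lemma mark_pos a v y : mark_of (upd m (4 * a + 3) v) y = mark_of m y.
Proof. by rewrite /mark_of /upd; case: eqP => //; lia. Qed.

Lemma nb_deg x v y i : nb_of n (upd m (4 * x) v) y i = nb_of n m y i.
Proof. by rewrite /nb_of /upd; case: eqP => //; lia. Qed.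
Lemma nb_nb x i v y j : i < n -> j < n ->
  nb_of n (upd m (4 * (x * n + i) + 2) v) y j =
  if (y == x) && (j == i) then v else nb_of n m y j.
Proof. by move=> Hi Hj; rewrite /nb_of /upd E //= cell_inj. Qed.
Lemma nb_pos a v y i : nb_of n (upd m (4 * a + 3) v) y i = nb_of n m y i.
Proof. by rewrite /nb_of /upd E. Qed.

Lemma pos_deg x v y i : pos_of n (upd m (4 * x) v) y i = pos_of n m y i.
Proof. by rewrite /pos_of /upd; case: eqP => //; lia. Qed.
Lemma pos_nb a v y i : pos_of n (upd m (4 * a + 2) v) y i = pos_of n m y i.
Proof. by rewrite /pos_of /upd E. Qed.
Lemma pos_pos x i v y j : i < n -> j < n ->
  pos_of n (upd m (4 * (x * n + i) + 3) v) y j =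
  if (y == x) && (j == i) then v else pos_of n m y j.
Proof. by move=> Hi Hj; rewrite /pos_of /upd E //= cell_inj. Qed.

Definition viewE := (deg_deg, deg_nb, deg_pos, mark_deg, mark_nb, mark_pos,
                     nb_deg, nb_pos, pos_deg, pos_nb).

(** The entries are pairwise distinct because the positions invert them, and they exhaust the
    vertices of nonzero position. *)
Lemma row_card x : row_ok n m x ->
  deg_of m x = #|[set w : 'I_n | pos_of n m x w != 0]|.
Proof.
case=> R1 R2.
pose f (i : 'I_(deg_of m x)) : 'I_n := Ordinal (proj1 (R1 i (ltn_ord i))).
have fi : injective f.
  move=> i j /(congr1 (fun o => pos_of n m x (val o))) /=.
  by rewrite (proj2 (R1 i _)) // (proj2 (R1 j _)) // => -[] /val_inj.
rewrite -[LHS]card_ord -(card_imset predT fi); apply: eq_card => w; rewrite !inE.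
apply/imsetP/idP => [[i _ ->] /=|H]; first by rewrite (proj2 (R1 i _)).
have [H1 H2] := R2 w (ltn_ord w) H.
have lt : (pos_of n m x w).-1 < deg_of m x by lia.
by exists (Ordinal lt) => //; apply: val_inj.
Qed.

Lemma row_card_le x : row_ok n m x -> deg_of m x <= n.
Proof. by move/row_card ->; rewrite -[leqRHS]card_ord max_card. Qed.

Lemma row_card_lt x w : w < n -> pos_of n m x w = 0 -> row_ok n m x ->
  deg_of m x < n.
Proof.
move=> Hw H /row_card ->; rewrite -[ltnRHS]card_ord -cardsT.
apply: proper_card; rewrite properE subsetT /=; apply/subsetPn.
by exists (Ordinal Hw); rewrite ?inE //= H.
Qed.

End Views.

Lemma cell_bound n x i : x <= n -> i <= n -> x * n + i <= n * n + n.
Proof. by move=> hx hi; rewrite leq_add // leq_mul2r hx orbT. Qed.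

(** * Insertion into and removal from a row *)

Definition add_row a b : cmd :=
  Seq (SetMem (eNb (Reg a) (Mem (eDeg (Reg a)))) (Reg b))
 (Seq (SetMem (ePos (Reg a) (Reg b)) (Bin Add (Mem (eDeg (Reg a))) (Const 1)))
      (SetMem (eDeg (Reg a)) (Bin Add (Mem (eDeg (Reg a))) (Const 1)))).

(** The last entry moves into the freed slot. The position of the removed vertex is cleared last, so
    that the code is also right when this vertex is itself the last entry. *)
Definition remove_row a b : cmd :=
  Seq (SetReg 7 (Mem (ePos (Reg a) (Reg b))))
 (Seq (SetMem (eDeg (Reg a)) (Bin Sub (Mem (eDeg (Reg a))) (Const 1)))
 (Seq (SetReg 8 (Mem (eNb (Reg a) (Mem (eDeg (Reg a))))))
 (Seq (SetMem (eNb (Reg a) (Bin Sub (Reg 7) (Const 1))) (Reg 8))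
 (Seq (SetMem (ePos (Reg a) (Reg 8)) (Reg 7))
      (SetMem (ePos (Reg a) (Reg b)) (Const 0)))))).

Section Rows.
Variables (n W : nat).
Hypothesis HW : 100 * (n * n + n + 1) < W.

Lemma add_row_spec a b s :
  reg s 0 = n -> rows_ok n (mem s) -> reg s a <= n -> reg s b < n ->
  pos_of n (mem s) (reg s a) (reg s b) = 0 ->
  wp W (add_row a b) s (fun s' t r =>
    [/\ reg s' = reg s, col s' = col s, rows_ok n (mem s'),
        (forall y z, z < n -> (pos_of n (mem s') y z != 0) =
           (y == reg s a) && (z == reg s b) || (pos_of n (mem s) y z != 0))
      & t <= 100 /\ r = 0]).
Proof.
case: s => rg m cl /= r0 [Hm Hr].
move Ex: (rg a) => x; move Ew: (rg b) => w Hx Hw P0.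
have Rx := Hr _ Hx; have Hd := row_card_lt Hw P0 Rx.
have B1 := cell_bound Hx (ltnW Hd); have B2 := cell_bound Hx (ltnW Hw).
apply: wp_seq; apply: wp_mem; rewrite /= ?Ex ?Ew ?r0 -?/(deg_of m _).
- by repeat split; lia.
- by [].
apply: wp_seq; apply: wp_mem; rewrite /= ?Ex ?Ew ?r0 -?/(deg_of (upd _ _ _) _) ?viewE.
- by repeat split; lia.
- by repeat split; lia.
apply: wp_mem; rewrite /= ?Ex ?Ew ?r0 -?/(deg_of (upd _ _ _) _) ?viewE.
- by repeat split; lia.
- by repeat split; lia.
set m' := upd (upd _ _ _) _ _.
have Dd y : deg_of m' y = if y == x then (deg_of m x).+1 else deg_of m y.
  by rewrite /m' !viewE addn1.
have Nn y i : i < n -> nb_of n m' y i =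
    if (y == x) && (i == deg_of m x) then w else nb_of n m y i.
  by move=> Hi; rewrite /m' !viewE nb_nb.
have Pp y z : z < n -> pos_of n m' y z =
    if (y == x) && (z == w) then (deg_of m x).+1 else pos_of n m y z.
  by move=> Hz; rewrite /m' !viewE pos_pos // viewE addn1.
have Mm c : mark_of m' c = 0 by rewrite /m' !viewE.
move: m' Dd Nn Pp Mm => m' Dd Nn Pp Mm.
split=> //; last by move=> y z Hz; rewrite Pp //; case: andP.
split=> // y Hy; have Hdy := row_card_le (Hr _ Hy).
case: (Hr _ Hy); rewrite /row_ok Dd.
case: (eqVneq y x) => [->|ne] R1 R2; last first.
  split=> [i Hi|z Hz].
    by rewrite Nn ?(negbTE ne) /=; [|lia]; have [h1 h2] := R1 i Hi; rewrite Pp ?(negbTE ne).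
  rewrite Pp ?(negbTE ne) //= => H; have [h1 h2] := R2 z Hz H.
  by split=> //; rewrite Nn ?(negbTE ne) //; lia.
split=> [i Hi|z Hz].
  rewrite Nn ?eqxx /=; last lia.
  case: eqP => [->|ne]; first by rewrite Pp // !eqxx.
  have [|h1 h2] := R1 i; first lia.
  split=> //; rewrite Pp // eqxx; case: eqP => //= Ez.
  by rewrite Ez P0 in h2.
rewrite Pp // eqxx /=; case: (eqVneq z w) => [->|ne] H.
  by split=> //; rewrite Nn //= !eqxx.
have [h1 h2] := R2 z Hz H; split; first lia.
by rewrite Nn ?eqxx /=; [case: eqP => // ?; lia|lia].
Qed.

Lemma remove_row_spec a b s :
  reg s 0 = n -> rows_ok n (mem s) -> reg s a <= n -> reg s b < n ->
  a < 7 -> b != 7 -> b != 8 ->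
  pos_of n (mem s) (reg s a) (reg s b) != 0 ->
  wp W (remove_row a b) s (fun s' t r =>
    [/\ (forall c, c != 7 -> c != 8 -> reg s' c = reg s c), col s' = col s,
        rows_ok n (mem s'),
        (forall y z, z < n -> (pos_of n (mem s') y z != 0) =
           ~~ ((y == reg s a) && (z == reg s b)) && (pos_of n (mem s) y z != 0))
      & t <= 100 /\ r = 0]).
Proof.
case: s => rg m cl /= r0 [Hm Hr].
move Ex: (rg a) => x; move Ew: (rg b) => w Hx Hw a7 b7 b8 P0.
have Rx := Hr _ Hx; have Hd := row_card_le Rx; have [R1 R2] := Rx.
have [p1 p2] := R2 w Hw P0.
have B2 := cell_bound Hx (ltnW Hw).
have d1 : (deg_of m x - 1) < n by lia.
have B1 := cell_bound Hx (ltnW d1).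
have [|l1 l2] := R1 (deg_of m x - 1); first lia.
have [q1 q2] : (a == 7) = false /\ (a == 8) = false by lia.
have q3 : pos_of n m x w - 1 < n by lia.
have B3 := cell_bound Hx (ltnW q3); have B4 := cell_bound Hx (ltnW l1).
apply: wp_seq; apply: wp_reg; rewrite /= ?Ex ?Ew ?r0.
  by repeat split; lia.
rewrite -/(pos_of n m x w).
have rA f v c : a != c -> upd f c v a = f a by rewrite /upd => /negbTE ->.
have rB f v c : b != c -> upd f c v b = f b by rewrite /upd => /negbTE ->.
have [qa7 qa8] : a != 7 /\ a != 8 by lia.
have rU f v c : upd f c v c = v by rewrite /upd eqxx.
have rN f v c c' : c' != c -> upd f c v c' = f c' by rewrite /upd => /negbTE ->.
apply: wp_seq; apply: wp_mem; rewrite /= ?rA // ?Ex ?Ew ?r0 -?/(deg_of m _).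
- by repeat split; lia.
- by repeat split; lia.
apply: wp_seq; apply: wp_reg;
  rewrite /= ?rA // [upd _ _ _ 0]rN // ?Ex ?Ew ?r0 -?/(deg_of (upd _ _ _) _)
    ?deg_deg ?eqxx.
  by repeat split; lia.
rewrite -/(nb_of n _ x _) nb_deg.
apply: wp_seq; apply: wp_mem;
  rewrite /= ?rA // ?rU ?[upd _ _ _ 0]rN // ?[upd _ 8 _ 7]rN // ?rU ?Ex ?r0.
  by repeat split; lia.
apply: wp_seq; apply: wp_mem;
  rewrite /= ?rA // ?rU ?[upd _ _ _ 0]rN // ?[upd _ 8 _ 7]rN // ?rU ?Ex ?r0.
  by repeat split; lia.
apply: wp_mem;
  rewrite /= ?rA // ?rB // ?[upd _ _ _ 0]rN // ?[upd _ _ _ 0]rN // ?Ex ?Ew ?r0.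
- by repeat split; lia.
- by lia.
set m' := upd (upd (upd _ _ _) _ _) _ _.
(* [i0] is the slot of the removed vertex, shifted by one, and [l] is the entry moved there,
   possibly that vertex itself. *)
set d := deg_of m x; set i0 := pos_of n m x w; set l := nb_of n m x (d - 1).
have Dd y : deg_of m' y = if y == x then d - 1 else deg_of m y.
  by rewrite /m' !viewE.
have Nn y i : i < n -> nb_of n m' y i =
    if (y == x) && (i == i0 - 1) then l else nb_of n m y i.
  by move=> Hi; rewrite /m' !viewE nb_nb // viewE.
have Pp y z : z < n -> pos_of n m' y z =
    if (y == x) && (z == w) then 0
    else if (y == x) && (z == l) then i0 else pos_of n m y z.
  by move=> Hz; rewrite /m' !pos_pos // !viewE.
have Mm c : mark_of m' c = 0 by rewrite /m' !viewE.
move: m' Dd Nn Pp Mm => m' Dd Nn Pp Mm.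
split=> //.
- by move=> c c7 c8; rewrite !rN.
- split=> // y Hy; have Hdy := row_card_le (Hr _ Hy).
  case: (Hr _ Hy); rewrite /row_ok Dd.
  case: (eqVneq y x) => [->|ne] S1 S2; last first.
    split=> [i Hi|z Hz].
      by rewrite Nn ?(negbTE ne) /=; [|lia]; have [h1 h2] := S1 i Hi; rewrite Pp ?(negbTE ne).
    rewrite Pp ?(negbTE ne) //= => H; have [h1 h2] := S2 z Hz H.
    by split=> //; rewrite Nn ?(negbTE ne) //; lia.
  split=> [i Hi|z Hz].
    rewrite Nn ?eqxx /=; last lia.
    have [|h1 h2] := R1 i; first lia.
    case: (eqVneq i (i0 - 1)) => [Ei|ne].
      split=> //; rewrite Pp ?eqxx //=; case: (eqVneq l w) => [E|_]; last lia.
      by move: l2; rewrite -/d -/l E -/i0; lia.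
    split=> //; rewrite Pp ?eqxx //=; case: (eqVneq _ w) => [E|_].
      by move: h2; rewrite E -/i0; lia.
    case: (eqVneq _ l) => [E|_] //.
    by move: l2; rewrite -/d -/l -E h2; lia.
  rewrite Pp // eqxx /=; case: (eqVneq z w) => // nw.
  case: (eqVneq z l) => [El|nl] H.
    (* Here [l] is not the removed vertex, so the freed slot is not the last one. *)
    have ni : i0 <> d.
      by move=> E; move: p2; rewrite -/i0 E -subn1 -/l => E'; rewrite El E' eqxx in nw.
    split; first by lia.
    by rewrite Nn ?eqxx -?subn1 /= ?eqxx //; lia.
  have [h1 h2] := R2 z Hz H.
  have n1 : pos_of n m x z <> d.
    by move=> E; move: h2; rewrite E -subn1 -/l => E'; rewrite E' eqxx in nl.
  have n2 : pos_of n m x z <> i0.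
    by move=> E; move: h2; rewrite E p2 => E'; rewrite E' eqxx in nw.
  split; first lia.
  rewrite Nn ?eqxx /=; last lia.
  by case: eqP => // ?; lia.
- move=> y z Hz; rewrite Pp //; case: (eqVneq y x) => //= ->.
  case: (eqVneq z w) => //= nw; case: (eqVneq z l) => // ->.
  by rewrite P0; apply/esym; rewrite l2.
Qed.


End Rows.

(** * Picking a free color, and searching the set [S] *)

(* Register 6 selects a row, and register 8 contains the first candidate color and
   finally the color that is picked. *)
Definition mark_row b : cmd :=
  Seq (SetReg 7 (Const 0))
      (While (Bin Lt (Reg 7) (Mem (eDeg (Reg 6))))
        (Seq (SetMem (eMark (Col (Mem (eNb (Reg 6) (Reg 7))))) (Const b))
             (SetReg 7 (Bin Add (Reg 7) (Const 1))))).

Definition find_free : cmd :=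
  While (Mem (eMark (Reg 8))) (SetReg 8 (Bin Add (Reg 8) (Const 1))).

Definition pick : cmd := Seq (mark_row 1) (Seq find_free (mark_row 0)).

(* Registers 4 and 5 persist between operations and start at 0: register 4 holds [K - 2],
   register 5 the number of edges. *)
Definition eK := Bin Add (Reg 4) (Const 2).

(* Register 9 receives a vertex of [S] of degree less than [K - 1], or [n]. *)
Definition scan : cmd :=
  Seq (SetReg 9 (Reg 0))
 (Seq (SetReg 7 (Const 0))
      (While (Bin Lt (Reg 7) (Mem (eDeg (Reg 0))))
        (Seq (If (Bin Lt (Bin Add (Mem (eDeg (Mem (eNb (Reg 0) (Reg 7))))) (Const 1)) eK)
                 (SetReg 9 (Mem (eNb (Reg 0) (Reg 7)))) Skip)
             (SetReg 7 (Bin Add (Reg 7) (Const 1)))))).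

Section Loops.
Variables (n W : nat).
Hypothesis HW : 100 * (n * n + n + 1) < W.

(** The same loop sets marks for [b = 1] and clears them for [b = 0]. The bound on the colors keeps
    the addresses of the marks within words. *)
Lemma mark_row_spec b s x d (f : nat -> nat) :
  b <= 1 -> reg s 0 = n -> reg s 6 = x -> x <= n -> deg_of (mem s) x = d -> d <= n ->
  (forall i, i < d -> nb_of n (mem s) x i = f i /\ col s (f i) <= n.+1) ->
  wp W (mark_row b) s (fun s' t r =>
    [/\ (forall c, c != 7 -> reg s' c = reg s c), col s' = col s,
        (forall a, mem s' a =
           if has (fun i => a == 4 * col s (f i) + 1) (iota 0 d) then b else mem s a)
      & t <= 100 * d.+1 /\ r = 0]).
Proof.
move=> b1 r0 r6 Hx Hd dn Hf.
apply: wp_seq; apply: wp_reg; first by rewrite /=; lia.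
pose I j s1 := [/\ reg s1 7 = j, (forall c, c != 7 -> reg s1 c = reg s c), col s1 = col s
  & (forall a, mem s1 a =
       if has (fun i => a == 4 * col s (f i) + 1) (iota 0 j) then b else mem s a)].
(* Only addresses congruent to 1 modulo 4 are written, so the size and the entries read by the loop
   stay the same. *)
have keep j s1 a : I j s1 -> (forall c, a <> 4 * c + 1) -> mem s1 a = mem s a.
  case=> _ _ _ -> H; case: hasP => // -[i _ /eqP E].
  by case: (H (col s (f i))).
apply: (@wp_while W _ _ d 50 I).
- split=> //=; last by move=> c /negbTE ne; rewrite /upd ne.
- move=> j s1 jd Ij; have [I7 Ir Ic Im] := Ij; have [Hn Hc] := Hf _ jd.
  have B := cell_bound Hx (leq_trans (ltnW jd) dn).
  have R6 : reg s1 6 = x by rewrite Ir.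
  have R0 : reg s1 0 = n by rewrite Ir.
  have D1 : mem s1 (4 * x) = d by rewrite (keep _ _ _ Ij) //; lia.
  have N1 : mem s1 (4 * (x * n + j) + 2) = f j by rewrite (keep _ _ _ Ij) //; lia.
  rewrite /= R6 I7 D1 jd; split=> //; first by repeat split; lia.
  apply: wp_seq; apply: wp_mem; rewrite /= ?R6 ?R0 ?I7 ?N1 ?Ic.
  + by repeat split; lia.
  + by lia.
  apply: wp_reg; rewrite /= ?I7; first by repeat split; lia.
  split=> //; split=> //.
  + by rewrite /= /upd /= addn1.
  + by move=> c ne; rewrite /= /upd (negbTE ne) Ir.
  + move=> a; rewrite -[j.+1]addn1 iotaD has_cat /= orbF add0n /upd Im.
    by case: eqP => //=; rewrite ?orbT ?orbF.
- move=> s1 Ij; have [I7 Ir Ic Im] := Ij.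
  have R6 : reg s1 6 = x by rewrite Ir.
  have D1 : mem s1 (4 * x) = d by rewrite (keep _ _ _ Ij) //; lia.
  rewrite /= R6 I7 D1 ltnn; repeat split; lia.
- move=> s1 t [I7 Ir Ic Im] /= Ht; split=> //; lia.
Qed.

Lemma find_free_spec s c0 d :
  reg s 8 = c0 -> c0 + d <= n.+1 ->
  (exists c, [/\ c0 <= c, c <= c0 + d & mark_of (mem s) c == 0]) ->
  wp W find_free s (fun s' t r =>
    [/\ (forall c, c != 8 -> reg s' c = reg s c), col s' = col s, mem s' = mem s,
        c0 <= reg s' 8 <= c0 + d /\ mark_of (mem s) (reg s' 8) = 0
      & t <= 100 * d.+1 /\ r = 0]).
Proof.
move=> r8 Hb Hex.
have Hex' : exists k, mark_of (mem s) (c0 + k) == 0.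
  by case: Hex => c [h1 h2 h3]; exists (c - c0); rewrite subnKC.
(* The number of iterations is the least offset of an unmarked color. *)
case: (ex_minnP Hex') => N /eqP HN min.
have Nd : N <= d.
  case: Hex => c [h1 h2 h3]; have := min (c - c0); rewrite subnKC // => /(_ h3); lia.
pose I j s1 := [/\ reg s1 8 = c0 + j, (forall c, c != 8 -> reg s1 c = reg s c),
  col s1 = col s & mem s1 = mem s].
apply: (@wp_while W _ _ N 50 I).
- by split; rewrite ?addn0.
- move=> j s1 jN [I8 Ir Ic Im]; rewrite /= I8 Im; split.
  + by repeat split; lia.
  + apply/negP => /eqP E; have := min j; rewrite /mark_of E => /(_ isT); lia.
  apply: wp_reg; rewrite /= ?I8; first by repeat split; lia.
  split=> //; split=> //=; first by rewrite /upd /=; lia.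
  by move=> c ne; rewrite /upd (negbTE ne) Ir.
- by move=> s1 [I8 Ir Ic Im]; rewrite /= I8 Im; split=> //; repeat split; lia.
- move=> s1 t [I8 Ir Ic Im] /= Ht; split=> //; last by lia.
  by rewrite I8; split=> //; lia.
Qed.

(** Pigeonhole: the row holds [d] vertices, so one of [d + 1] consecutive colors is free. The second
    pass clears the marks set by the first, and all marks were zero before, so the whole memory is
    restored. *)
Lemma pick_spec s x d c0 :
  reg s 0 = n -> rows_ok n (mem s) -> reg s 6 = x -> x <= n ->
  deg_of (mem s) x = d -> reg s 8 = c0 -> c0 + d <= n.+1 ->
  (forall w, w < n -> col s w <= n.+1) ->
  wp W pick s (fun s' t r =>
    [/\ (forall c, c != 7 -> c != 8 -> reg s' c = reg s c), col s' = col s, mem s' = mem s,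
        c0 <= reg s' 8 <= c0 + d /\
        (forall w, w < n -> pos_of n (mem s) x w != 0 -> col s w <> reg s' 8)
      & t <= 300 * d.+1 /\ r = 0]).
Proof.
move=> r0 [Mz Hr] r6 Hx Hd r8 Hb Hc.
have dn : d <= n by rewrite -Hd; apply/row_card_le/Hr.
have [R1 R2] := Hr _ Hx; rewrite Hd in R1 R2.
pose f := nb_of n (mem s) x.
have Hf i : i < d -> f i < n by move=> /R1 [].
apply: wp_seq; apply: (wp_mono (@mark_row_spec 1 s x d f _ _ _ _ _ _ _)) => //.
  by move=> i id; split=> //; apply/Hc/Hf.
move=> s1 t1 r1 [Ir1 Ic1 Im1 [Ht1 ->]].
have Mk c : mark_of (mem s1) c = (c \in [seq col s (f i) | i <- iota 0 d]).
  rewrite /mark_of Im1 -has_pred1 has_map.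
  have -> : has (fun i => 4 * c + 1 == 4 * col s (f i) + 1) (iota 0 d) =
     has (preim (fun i => col s (f i)) (pred1 c)) (iota 0 d).
    by apply: eq_has => i /=; lia.
  by case: has => //; apply: Mz.
apply: wp_seq; apply: (wp_mono (@find_free_spec s1 c0 d _ _ _)) => //.
- by rewrite Ir1.
- case: (boolP (all (fun c => c \in [seq col s (f i) | i <- iota 0 d]) (iota c0 d.+1))).
    move/allP/(uniq_leq_size (iota_uniq _ _)).
    by rewrite size_map !size_iota ltnn.
  case/allPn => c; rewrite mem_iota => Hc1 Hc2; exists c; split; [lia|lia|].
  by rewrite Mk (negbTE Hc2).
move=> s2 t2 r2 [Ir2 Ic2 Im2 [Hc2 Hm2] [Ht2 ->]].
apply: (wp_mono (@mark_row_spec 0 s2 x d f _ _ _ _ _ _ _)) => //.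
- by rewrite Ir2 // Ir1.
- by rewrite Ir2 // Ir1.
- rewrite Im2 /deg_of Im1; case: hasP => // -[i _ /eqP]; lia.
- move=> i id; split; last by rewrite Ic2 Ic1; apply/Hc/Hf.
  rewrite Im2 /f /nb_of Im1; case: hasP => // -[i' _ /eqP]; lia.
move=> s3 t3 r3 [Ir3 Ic3 Im3 [Ht3 ->]]; split.
- by move=> c c7 c8; rewrite Ir3 // Ir2 // Ir1.
- by rewrite Ic3 Ic2.
- apply: functional_extensionality => a; rewrite Im3 Im2 Im1 Ic2 Ic1.
  by case: hasP => // -[i _ /eqP ->]; rewrite -[LHS](Mz (col s (f i))).
- rewrite Ir3 //; split=> // w wn Hw E; move: Hm2; rewrite Mk -E.
  have [h1 h2] := R2 _ wn Hw.
  suff -> : col s w \in [seq col s (f i) | i <- iota 0 d] by [].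
  apply/mapP; exists (pos_of n (mem s) x w).-1; last by rewrite /f h2.
  by rewrite mem_iota; lia.
- by split=> //; lia.
Qed.

(** The loop does not stop at a hit: register 9 keeps the last one, and its initial value [n], which
    is no vertex, survives exactly when there is none. *)
Lemma scan_spec s K : reg s 0 = n -> rows_ok n (mem s) -> reg s 4 + 2 = K -> K < W ->
  wp W scan s (fun s' t r =>
    [/\ (forall c, c != 7 -> c != 9 -> reg s' c = reg s c), col s' = col s, mem s' = mem s,
        (reg s' 9 = n /\ forall w, w < n -> pos_of n (mem s) n w != 0 ->
           K <= deg_of (mem s) w + 1) \/
        [/\ reg s' 9 < n, pos_of n (mem s) n (reg s' 9) != 0
          & deg_of (mem s) (reg s' 9) + 1 < K]
      & t <= 300 * (deg_of (mem s) n).+1 /\ r = 0]).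
Proof.
move=> r0 [Mz Hr] r4 KW.
have [R1 R2] := Hr _ (leqnn n); have dn := row_card_le (Hr _ (leqnn n)).
move: R1 R2 dn; set d := deg_of _ _ => R1 R2 dn.
apply: wp_seq; apply: wp_reg => //.
apply: wp_seq; apply: wp_reg; first by rewrite /=; lia.
pose I j s1 := [/\ reg s1 7 = j, (forall c, c != 7 -> c != 9 -> reg s1 c = reg s c),
  col s1 = col s, mem s1 = mem s
  & (reg s1 9 = n /\ forall i, i < j -> K <= deg_of (mem s) (nb_of n (mem s) n i) + 1) \/
    [/\ reg s1 9 < n, pos_of n (mem s) n (reg s1 9) != 0
      & deg_of (mem s) (reg s1 9) + 1 < K]].
apply: (@wp_while W _ _ d 100 I).
- split=> //=.
    by move=> c c7 c9; rewrite /upd (negbTE c7) (negbTE c9).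
  by left; rewrite /upd /= r0.
- move=> j s1 jd [I7 Ir Ic Im I9].
  have R0 : reg s1 0 = n by rewrite Ir.
  have R4 : reg s1 4 = reg s 4 by rewrite Ir.
  have [Hn Hp] := R1 _ jd.
  have B := cell_bound (leqnn n) (leq_trans (ltnW jd) dn).
  rewrite /= R0 I7 Im -/(deg_of (mem s) n) -/d jd; split=> //; first by repeat split; lia.
  have dw := row_card_le (Hr _ (ltnW Hn)).
  apply: wp_seq; apply: wp_if; rewrite /= ?R0 ?R4 ?I7 ?Im -?/(nb_of n (mem s) _ _)
    -?/(deg_of (mem s) _) ?r4.
    by repeat split; lia.
  case: ltnP => H /=.
    apply: wp_reg; rewrite /= ?R0 ?R4 ?I7 ?Im -?/(nb_of n (mem s) _ _).
      by repeat split; lia.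
    apply: wp_reg; rewrite /= /upd /= ?I7; first by repeat split; lia.
    split=> //; split=> //; rewrite /= /upd /= ?addn1 //.
      by move=> c c7 c9; rewrite (negbTE c7) (negbTE c9) Ir.
    by right; rewrite Hp; split=> //; lia.
  apply: wp_skip; apply: wp_reg; rewrite /= /upd /= ?I7; first by repeat split; lia.
  split=> //; split=> //; rewrite /= /upd /= ?addn1 //.
    by move=> c c7 c9; rewrite (negbTE c7) Ir.
  case: I9 => [[E h]|]; [left|by rewrite addn1 => H9; right].
  split=> // i; rewrite ltnS leq_eqVlt => /orP[/eqP -> //|]; exact: h.
- move=> s1 [I7 Ir Ic Im I9]; rewrite /= I7 Im Ir // r0 -/(deg_of (mem s) n) -/d ltnn.
  by repeat split; lia.
- move=> s1 t [I7 Ir Ic Im I9] /= Ht; split=> //; last by lia.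
  case: I9 => [[E h]|]; [left|by right].
  split=> // w wn Hw; have [h1 h2] := R2 _ wn Hw.
  by rewrite -{1}h2; apply: h; lia.
Qed.

End Loops.

(** * Graphs and the potential *)

Section Graphs.
Variable n : nat.
Implicit Types (G : graph n) (S : {set 'I_n}) (u v w x y : 'I_n) (K : nat).

Lemma set2_eq u v x y :
  ([set x; y] == [set u; v]) = (x == u) && (y == v) || (x == v) && (y == u).
Proof.
apply/eqP/orP => [E|[|] /andP[/eqP -> /eqP ->] //]; last exact: setUC.
have := set21 x y; have := set22 x y; have := set21 u v; have := set22 u v.
rewrite E -{1 2}E !inE; do 4! case/orP=> /eqP ?; subst;
  rewrite ?eqxx ?andbT; by [left|right|rewrite eq_sym; left|rewrite eq_sym; right].
Qed.

Lemma adj_sym G u v : adj G u v = adj G v u.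
Proof. by rewrite /adj setUC. Qed.

Lemma adj_insert G u v x y : adj ([set u; v] |: G) x y =
  (x == u) && (y == v) || (x == v) && (y == u) || adj G x y.
Proof. by rewrite /adj in_setU1 set2_eq. Qed.

Lemma adj_delete G u v x y : adj (G :\ [set u; v]) x y =
  ~~ ((x == u) && (y == v) || (x == v) && (y == u)) && adj G x y.
Proof. by rewrite /adj in_setD1 set2_eq. Qed.

Lemma degree_insert G u v w : u != v -> ~~ adj G u v ->
  degree ([set u; v] |: G) w = degree G w + (w == u) + (w == v).
Proof.
move=> uv nuv; rewrite /degree.
have [->|wu] := eqVneq w u.
  have -> : [set y | adj ([set u; v] |: G) u y] = v |: [set y | adj G u y].
    by apply/setP => y; rewrite !inE adj_insert eqxx (negbTE uv) /= orbF.
  by rewrite cardsU1 inE nuv (negbTE uv); lia.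
have [->|wv] := eqVneq w v.
  have -> : [set y | adj ([set u; v] |: G) v y] = u |: [set y | adj G v y].
    by apply/setP => y; rewrite !inE adj_insert eqxx eq_sym (negbTE uv).
  by rewrite cardsU1 inE adj_sym nuv; lia.
by rewrite !addn0; apply: eq_card => y; rewrite !inE adj_insert (negbTE wu) (negbTE wv).
Qed.

Lemma degree_delete G u v w : u != v -> adj G u v ->
  degree G w = degree (G :\ [set u; v]) w + (w == u) + (w == v).
Proof.
move=> uv auv; rewrite -{1}(setD1K auv) degree_insert //.
by rewrite adj_delete !eqxx.
Qed.

Lemma degree_le G v : degree G v <= n.
Proof. by rewrite -[leqRHS]card_ord max_card. Qed.

(** This is [minn 2 (K - d)]: it never increases with [d], and it changes by at most one when [d]
    does. *)
Definition penalty K d : nat := 2 * (d + 2 <= K) + (d + 1 == K).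

Definition potential G S K : nat := \sum_(v in S) penalty K (degree G v).

(** The absence of loops and the handshake identity are carried along because they fail for
    arbitrary sets of vertex sets. *)
Record bounded G S K : Prop := Bounded {
  bounded_loop : forall u, ~~ adj G u u;
  bounded_sum : \sum_v degree G v = 2 * #|G|;
  bounded_ge2 : 2 <= K;
  bounded_edges : #|G| <= K * K;
  bounded_pot : potential G S K <= 8 * K }.

Lemma sum_eq1 u : \sum_v (v == u : nat) = 1.
Proof. by rewrite (bigD1 u) //= eqxx big1 // => v /negbTE ->. Qed.

Lemma sum_in_eq1 S u : \sum_(v in S) (v == u : nat) <= 1.
Proof.
rewrite -(sum_eq1 u) big_mkcond leq_sum // => v _.
by case: ifP.
Qed.

(** The degrees sum to at most [2 * K * K], which is at most [4 * K * (K - 1)] as [K] is at least 2;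
    each vertex counted contributes at least [K - 1]. *)
Lemma heavy_count G S K : bounded G S K ->
  #|[set v | K <= degree G v + 1]| <= 4 * K.
Proof.
case=> _ Hs K2 Hm _.
have : #|[set v | K <= degree G v + 1]| * (K - 1) <= 2 * #|G|.
  rewrite -Hs -sum_nat_const big_mkcond leq_sum // => v _.
  by case: ifP => //; rewrite inE; lia.
move=> H; have : #|[set v | K <= degree G v + 1]| * (K - 1) <= 4 * K * (K - 1).
  by apply: leq_trans H _; case: K K2 Hm => [|[|k]] // _ Hm; nia.
by rewrite leq_pmul2r //; lia.
Qed.

Lemma sum_le_card (A S : {set 'I_n}) (f g : 'I_n -> nat) :
  (forall v, f v <= g v + 2 * (v \in A)) ->
  \sum_(v in S) f v <= \sum_(v in S) g v + 2 * #|A|.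
Proof.
move=> H; have := @leq_sum _ (index_enum _) (fun v => v \in S) _ _ (fun v _ => H v).
move/leq_trans; apply; rewrite big_split /= leq_add2l -big_distrr leq_mul2l /=.
rewrite -sum1_card [leqRHS]big_mkcond [leqLHS]big_mkcond.
by apply: leq_sum => v _; do 2! case: (_ \in _).
Qed.

(** A vertex of [S] either has penalty 2 or is one of the at most [4 * K] vertices of degree at
    least [K - 1]. Hence twice the size of [S] is at most [8 * K + 2 * (4 * K)]. *)
Lemma bounded_card G S K : bounded G S K -> #|S| <= 8 * K.
Proof.
move=> B; have hc := heavy_count B; have hp := bounded_pot B.
suff : #|S| * 2 <= potential G S K + 2 * #|[set v | K <= degree G v + 1]| by lia.
rewrite -sum_nat_const; apply: sum_le_card => v; rewrite inE /penalty; lia.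
Qed.

(** Vertices of degree less than [K - 1] already have the maximal penalty 2. The others, at most
    [4 * K] of them, gain at most 2 each, so the potential grows by at most [8 * K], just as its
    bound does. *)
Lemma bounded_double G S K : bounded G S K -> bounded G S (K + K).
Proof.
move=> B; have hc := heavy_count B; case: B => h1 h2 h3 h4 h5; split=> //; try nia.
suff : potential G S (K + K) <= potential G S K + 2 * #|[set v | K <= degree G v + 1]|.
  by lia.
apply: sum_le_card => v; rewrite inE /penalty; lia.
Qed.

Lemma bounded_insert G S K u v : bounded G S K -> u != v -> ~~ adj G u v ->
  #|G|.+1 <= K * K -> bounded ([set u; v] |: G) S K.
Proof.
case=> h1 h2 h3 h4 h5 uv nuv hm; split=> //.
- move=> x; rewrite adj_insert negb_or h1 andbT.
  by apply/negP => /orP[] /andP[/eqP -> /eqP E]; rewrite E eqxx in uv.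
- under eq_bigr => w _ do rewrite degree_insert //.
  by rewrite !big_split /= h2 !sum_eq1 cardsU1 nuv; lia.
- by rewrite cardsU1 nuv.
- apply: leq_trans h5; apply: leq_sum => w _; rewrite degree_insert // /penalty.
  by case: eqP; case: eqP; lia.
Qed.

(** A vertex of degree at least [K] has penalty 0. *)
Lemma bounded_add G S K u : bounded G S K -> K <= degree G u -> bounded G (u |: S) K.
Proof.
case=> h1 h2 h3 h4 h5 Ku; split=> //.
apply: leq_trans h5; rewrite /potential.
have [uS|nS] := boolP (u \in S); first by rewrite (setUidPr _) ?sub1set.
by rewrite big_setU1 //= /penalty; lia.
Qed.

Lemma penalty_drop K d : penalty K d <= (penalty K d.+1).+1.
Proof. by rewrite /penalty; lia. Qed.

Section Delete.
Variables (G : graph n) (S : {set 'I_n}) (K : nat) (u v : 'I_n).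
Hypotheses (B : bounded G S K) (auv : adj G u v).
Let G' := G :\ [set u; v].

Lemma adj_neq : u != v.
Proof. by apply: contraTneq auv => ->; apply: (bounded_loop B). Qed.

Lemma card_delete : #|G| = #|G'|.+1.
Proof. by rewrite (cardsD1 [set u; v]) -/(adj G u v) auv. Qed.

Lemma bounded_delete S' : potential G' S' K <= 8 * K -> bounded G' S' K.
Proof.
have uv := adj_neq; have cG := card_delete; case: B => h1 h2 h3 h4 h5 hp.
split=> //; last 1 first.
- by lia.
- by move=> x; rewrite adj_delete negb_and h1 orbT.
have : \sum_x degree G x = \sum_x degree G' x + 1 + 1.
  under eq_bigr => w _ do rewrite (degree_delete _ uv auv).
  by rewrite !big_split /= !sum_eq1.
by lia.
Qed.

(** The deletion lowers two degrees by one and so adds at most 2 to the potential; removing [w], of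
    penalty 2, pays for it. *)
Lemma bounded_delete_remove w : w \in S -> degree G' w + 1 < K ->
  bounded G' (S :\ w) K.
Proof.
move=> wS dw; apply: bounded_delete; have uv := adj_neq.
have : potential G' S K <= potential G S K + 1 + 1.
  apply: leq_trans (leq_add (leq_add (leqnn _) (sum_in_eq1 S u)) (sum_in_eq1 S v)).
  rewrite /potential -!big_split leq_sum // => x _ /=.
  rewrite (degree_delete x uv auv) -/G'.
  have := penalty_drop K (degree G' x).
  have [->|_] := eqVneq x u; first by rewrite (negbTE uv) /= !addn0 !addn1.
  by case: (x == v); rewrite /= ?addn0 ?addn1 //; lia.
rewrite {1}/potential (big_setD1 w) //= -/(potential G' _ _) {1}/penalty.
have -> : degree G' w + 2 <= K by lia.
by have := bounded_pot B; move: (potential _ _ _) (potential _ _ _); lia.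
Qed.

(** Now every vertex of [S] has penalty at most 1 and had degree at least [K - 1] before the
    deletion, so the potential is at most [4 * K]. *)
Lemma bounded_delete_keep : (forall w, w \in S -> K <= degree G' w + 1) ->
  bounded G' S K.
Proof.
move=> H; apply: bounded_delete.
have hc := heavy_count B.
suff : potential G' S K <= #|[set w | K <= degree G w + 1]| by lia.
rewrite -sum1_card [leqRHS]big_mkcond /potential [leqLHS]big_mkcond; apply: leq_sum => w _.
case: ifP => [wS|_]; last by case: ifP.
have := H _ wS; rewrite inE (degree_delete w adj_neq auv) -/G' /penalty.
by case: ifP; lia.
Qed.

End Delete.
End Graphs.

(** * The dynamic coloring algorithm *)

(** Since register 4 holds [K - 2], doubling [K] turns its content [r] into [2 * r + 2]. *)
Definition insert_edge : cmd :=
  Seq (add_row 1 2)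
 (Seq (add_row 2 1)
 (Seq (SetReg 5 (Bin Add (Reg 5) (Const 1)))
      (If (Bin Lt (Bin Mul eK eK) (Reg 5))
          (SetReg 4 (Bin Add (Bin Add (Reg 4) (Reg 4)) (Const 2))) Skip))).

(** Register 0 holds [n], the number of the row of [S]. The product in the last test is a
    conjunction: the new color exceeds [K] and the vertex is not yet in [S]. *)
Definition recolor : cmd :=
  Seq (If (Bin Lt (Bin Add eK (Mem (eDeg (Reg 0)))) (Mem (eDeg (Reg 1))))
          (Seq (SetReg 6 (Reg 0)) (SetReg 8 (Bin Add eK (Const 1))))
          (Seq (SetReg 6 (Reg 1)) (SetReg 8 (Const 1))))
 (Seq pick
 (Seq (SetCol (Reg 1) (Reg 8))
      (If (Bin Mul (Bin Lt eK (Reg 8)) (Bin Eq (Mem (ePos (Reg 0) (Reg 1))) (Const 0)))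
          (add_row 0 1) Skip))).

Definition delete_edge : cmd :=
  Seq (remove_row 1 2)
 (Seq (remove_row 2 1)
      (SetReg 5 (Bin Sub (Reg 5) (Const 1)))).

(** The degree of the vertex in register 9 is less than [K - 1], so its neighborhood can be scanned
    in time linear in [K], and its least free color is less than [K]. *)
Definition clean : cmd :=
  Seq (remove_row 0 9)
 (Seq (SetReg 6 (Reg 9))
 (Seq (SetReg 8 (Const 1))
 (Seq pick
      (SetCol (Reg 9) (Reg 8))))).

Definition coloring_algorithm : algorithm := Algorithm
  (Seq insert_edge (If (Bin Eq (Col (Reg 1)) (Col (Reg 2))) recolor Skip))
  (Seq delete_edge (Seq scan (If (Bin Lt (Reg 9) (Reg 0)) clean Skip)))
  (SetReg 3 (Col (Reg 1))).

(** * Invariants and correctness of the updates *)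

Section Store.
Variables (n W M : nat).
Hypothesis HW : 100 * (n * n + n + 1) < W.
Implicit Types (s : state) (G : graph n) (S : {set 'I_n}) (u v w x y : 'I_n).

(** [M] bounds the number of edges over the whole sequence. The maximum with 1 in [st_KM] allows for
    the initial value [K = 2]; [st_Kn] serves to keep [K] within words. *)
Record store s G S : Prop := Store {
  st_n : reg s 0 = n;
  st_rows : rows_ok n (mem s);
  st_adj : forall u w, (pos_of n (mem s) u w != 0) = adj G u w;
  st_S : forall w, (pos_of n (mem s) n w != 0) = (w \in S);
  st_m : reg s 5 = #|G|;
  st_bounded : bounded G S (reg s 4 + 2);
  st_KM : (reg s 4 + 2) * (reg s 4 + 2) <= 4 * maxn 1 M;
  st_Kn : reg s 4 + 2 <= 2 * n }.

Lemma store_ext s s' G S :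
  reg s' 0 = reg s 0 -> reg s' 4 = reg s 4 -> reg s' 5 = reg s 5 -> mem s' = mem s ->
  store s G S -> store s' G S.
Proof. by move=> r0 r4 r5 m [*]; split; rewrite ?r0 ?r4 ?r5 ?m. Qed.

Lemma store_deg s G S u : store s G S -> deg_of (mem s) u = degree G u.
Proof.
move=> H; have [_ R] := st_rows H; rewrite (row_card (R _ (ltnW (ltn_ord u)))).
by apply: eq_card => w; rewrite !inE (st_adj H).
Qed.

Lemma store_card s G S : store s G S -> deg_of (mem s) n = #|S|.
Proof.
move=> H; have [_ R] := st_rows H; rewrite (row_card (R _ (leqnn n))).
by apply: eq_card => w; rewrite !inE (st_S H).
Qed.

Lemma ord_neqn u : (n == u :> nat) = false.
Proof. by have := ltn_ord u; lia. Qed.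

Lemma sum_degree_le G : \sum_v degree G v <= n * n.
Proof.
rewrite -[X in _ <= X * n]card_ord -sum_nat_const leq_sum // => v _; exact: degree_le.
Qed.

(** One doubling suffices, as an insertion adds one edge. It happens only if [K * K <= #|G|], and
    [#|G|] is less than [M] and at most [n * n], so both bounds on [K] survive. *)
Lemma insert_edge_spec s G S u v :
  store s G S -> reg s 1 = u -> reg s 2 = v -> u != v -> ~~ adj G u v -> #|G| < M ->
  wp W insert_edge s (fun s' t r =>
    [/\ store s' ([set u; v] |: G) S, reg s' 1 = u /\ reg s' 2 = v, col s' = col s,
        reg s 4 <= reg s' 4 & t <= 500 /\ r = 0]).
Proof.
move=> H r1 r2 uv nuv GM; have un := ltn_ord u; have vn := ltn_ord v.
have [r0 R A AS rm B KM Kn] := H.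
apply: wp_seq; apply: (wp_mono (@add_row_spec n W HW 1 2 s r0 R _ _ _)).
- by rewrite r1; lia.
- by rewrite r2.
- by apply/eqP; rewrite r1 r2 -[_ == _]negbK A.
move=> s1 t1 w1 [E1 C1 R1 P1 [T1 ->]]; rewrite r1 r2 in P1.
apply: wp_seq; apply: (wp_mono (@add_row_spec n W HW 2 1 s1 _ R1 _ _ _)); rewrite ?E1 //.
- by rewrite r2; lia.
- by rewrite r1.
- apply/eqP; rewrite r1 r2 -[_ == _]negbK P1 // A adj_sym (negbTE nuv) orbF.
  by rewrite val_eqE eq_sym (negbTE uv).
move=> s2 t2 w2 [E2 C2 R2 P2 [T2 ->]]; rewrite ?E1 ?r1 ?r2 in E2 P2.
have m1 : #|[set u; v] |: G| = #|G|.+1 by rewrite cardsU1 nuv.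
have A2 x y : (pos_of n (mem s2) x y != 0) = adj ([set u; v] |: G) x y.
  by rewrite P2 // P1 // A adj_insert !val_eqE orbA; congr (_ || _); rewrite orbC.
have S2 w : (pos_of n (mem s2) n w != 0) = (w \in S).
  by rewrite P2 // P1 // AS !ord_neqn.
have Gn : 2 * #|G| <= n * n by rewrite -(bounded_sum B) sum_degree_le.
have GK := bounded_edges B.
apply: wp_seq; apply: wp_reg; rewrite /= E2 rm; first by repeat split; lia.
apply: wp_if; rewrite /= /upd /= E2.
  by repeat split; nia.
case: ltnP => Hm /=.
  have B2 := bounded_insert (bounded_double B) uv nuv.
  apply: wp_reg; rewrite /= /upd /= E2; first by repeat split; nia.
  split; rewrite /= ?C2 //; last by lia.
    split; rewrite /= /upd //= ?m1 ?E2 ?addn1 //.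
    + have -> : reg s 4 + reg s 4 + 2 + 2 = reg s 4 + 2 + (reg s 4 + 2) by lia.
      by apply: B2; nia.
    + have -> : (reg s 4 + reg s 4 + 2 + 2) * (reg s 4 + reg s 4 + 2 + 2) =
        4 * ((reg s 4 + 2) * (reg s 4 + 2)) by nia.
      rewrite leq_mul2l /=; move: Hm; rewrite addn1 ltnS => Hm.
      exact: leq_trans Hm (leq_trans (ltnW GM) (leq_maxr _ _)).
    + have : (reg s 4 + 2) * (reg s 4 + 2) <= n * n.
        move: Hm; rewrite addn1 ltnS => Hm; apply: leq_trans Hm (leq_trans _ Gn).
        exact: leq_pmull.
      by rewrite !mulnn leq_sqr; lia.
  by rewrite /upd /=; lia.
apply: wp_skip; split; rewrite /= ?C2 //; try by rewrite /upd /= E2.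
  2: by lia.
split; rewrite /= /upd //= ?m1 ?E2 ?addn1 //.
by apply: bounded_insert => //; move: Hm; rewrite addn1.
Qed.

(** The conclusion is not yet [store]: the potential may exceed its bound until the search of [S]
    has found a vertex to remove or shown that there is none. *)
Lemma delete_edge_spec s G S u v :
  store s G S -> reg s 1 = u -> reg s 2 = v -> adj G u v ->
  let G' := G :\ [set u; v] in
  wp W delete_edge s (fun s' t r =>
    [/\ reg s' 0 = n /\ rows_ok n (mem s'),
        (forall x y, (pos_of n (mem s') x y != 0) = adj G' x y),
        (forall w, (pos_of n (mem s') n w != 0) = (w \in S)),
        [/\ reg s' 4 = reg s 4, reg s' 5 = #|G'| & col s' = col s] & t <= 500 /\ r = 0]).
Proof.
move=> H r1 r2 auv G'; have un := ltn_ord u; have vn := ltn_ord v.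
have [r0 R A AS rm B KM Kn] := H; have uv := adj_neq B auv.
apply: wp_seq; apply: (wp_mono (@remove_row_spec n W HW 1 2 s r0 R _ _ _ _ _ _)) => //.
- by rewrite r1; lia.
- by rewrite r2.
- by rewrite r1 r2 A.
move=> s1 t1 w1 [E1 C1 R1 P1 [T1 ->]]; rewrite r1 r2 in P1.
apply: wp_seq.
apply: (wp_mono (@remove_row_spec n W HW 2 1 s1 _ R1 _ _ _ _ _ _)); rewrite ?E1 //.
- by rewrite r2; lia.
- by rewrite r1.
- by rewrite r1 r2 P1 // A adj_sym auv !val_eqE eq_sym (negbTE uv).
move=> s2 t2 w2 [E2 C2 R2 P2 [T2 ->]]; rewrite ?E1 // ?r1 ?r2 in P2.
have m1 : #|G| = #|G'|.+1 by apply: card_delete.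
have Gn : 2 * #|G| <= n * n by rewrite -(bounded_sum B) sum_degree_le.
apply: wp_reg; rewrite /= E2 // E1 // rm; first by repeat split; lia.
split=> //=; last by lia.
- by rewrite /upd /= E2 // E1.
- move=> x y; rewrite P2 // P1 // A adj_delete !val_eqE negb_or -andbA.
  by do 2! case: (~~ _).
- by move=> w; rewrite P2 // P1 // AS !ord_neqn.
- by rewrite /upd /= E2 // E1 // C2 C1 m1 subn1.
Qed.

Variable D : nat.

Record partial_coloring s G S u : Prop := PartialColoring {
  pc_range : forall w, 1 <= col s w <= D.+1;
  pc_proper : forall x y, adj G x y -> x != u -> y != u -> col s x <> col s y;
  pc_high : forall w, reg s 4 + 2 < col s w -> w != u -> w \in S }.

Record inv s G S : Prop := Inv {
  inv_store : store s G S;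
  inv_proper : proper_coloring G D.+1 (fun v : 'I_n => col s v);
  inv_high : forall w, reg s 4 + 2 < col s w -> w \in S }.

Lemma proper_recolor G (f : nat -> nat) u c :
  ~~ adj G u u ->
  (forall w, 1 <= f w <= D.+1) -> 1 <= c <= D.+1 ->
  (forall x y, adj G x y -> x != u -> y != u -> f x <> f y) ->
  (forall w, adj G u w -> f w <> c) ->
  proper_coloring G D.+1 (fun v : 'I_n => upd f u c v).
Proof.
move=> lu fr cr fp fc; rewrite /upd; split=> [w|x y]; first by case: ifP.
rewrite !val_eqE; case: (eqVneq x u) => [->|xu]; case: (eqVneq y u) => [->|yu] a.
- by rewrite a in lu.
- by move=> E; apply: (fc y).
- by apply: fc; rewrite adj_sym.
- exact: fp.
Qed.

Hypothesis Dn : D <= n.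

Lemma recolor_spec s G S u :
  store s G S -> reg s 1 = u -> (forall v, degree G v <= D) ->
  partial_coloring s G S u ->
  wp W recolor s (fun s' t r =>
    [/\ (exists S', inv s' G S'), reg s' 4 = reg s 4
      & t <= 3500 * (reg s 4 + 2) /\ r <= 1]).
Proof.
move=> H r1 HD [pr pp ph]; have un := ltn_ord u; have un' := ltnW un.
have [r0 R A AS rm B KM Kn] := H; have [Rm Rr] := R.
have hS := store_card H; have hu := store_deg u H; have du := degree_le G u.
have cS := bounded_card B; have cS' := row_card_le (Rr _ (leqnn n)).
have Sn : #|S| <= n by rewrite -hS.
have colb (w : nat) : w < n -> col s w <= n.+1.
  by move=> wn; have := pr (Ordinal wn) => /=; lia.
apply: wp_seq.
(* Both cases become one: [x] is the row to avoid, [d] its size, and [c0] the first candidate. The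
   bound [9 * K] on [d] is [K + #|S|] with [#|S| <= 8 * K]. *)
have : exists x d c0 : nat, [/\ x <= n, deg_of (mem s) x = d, 1 <= c0, c0 + d <= (degree G u).+1
    & d <= 9 * (reg s 4 + 2)] /\
    ((x = u) \/ (x = n /\ c0 = reg s 4 + 3)) /\
    wp W (If (Bin Lt (Bin Add eK (Mem (eDeg (Reg 0)))) (Mem (eDeg (Reg 1))))
          (Seq (SetReg 6 (Reg 0)) (SetReg 8 (Bin Add eK (Const 1))))
          (Seq (SetReg 6 (Reg 1)) (SetReg 8 (Const 1)))) s
      (fun s' t r => [/\ (forall c, c != 6 -> c != 8 -> reg s' c = reg s c),
         reg s' 6 = x /\ reg s' 8 = c0, col s' = col s, mem s' = mem s & t <= 100 /\ r = 0]).
  case: (ltnP (reg s 4 + 2 + #|S|) (degree G u)) => Hlt.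
    exists n, #|S|, (reg s 4 + 3); split; first by split=> //; lia.
    split; first by right.
    apply: wp_if; rewrite /= ?r0 ?r1 -?/(deg_of (mem s) _) ?hS ?hu.
      by repeat split; lia.
    rewrite Hlt /=; apply: wp_seq; apply: wp_reg => //.
    apply: wp_reg; rewrite /= /upd /=; first by repeat split; lia.
    split=> //=; rewrite /upd /=.
      by move=> c /negbTE -> /negbTE ->.
    by rewrite r0; split=> //; lia.
  exists u, (degree G u), 1; split; first by split=> //; lia.
  split; first by left.
  apply: wp_if; rewrite /= ?r0 ?r1 -?/(deg_of (mem s) _) ?hS ?hu.
    by repeat split; lia.
  rewrite ltnNge Hlt /=; apply: wp_seq; apply: wp_reg => //.
  apply: wp_reg; rewrite /= /upd /=; first by lia.
  split=> //=; rewrite /upd /=.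
  by move=> c /negbTE -> /negbTE ->.
case=> x [d [c0 [[xn xd c01 c0d dK] [xor X]]]].
apply: (wp_mono X) => s1 t1 w1 [E1 [x6 c8] C1 M1 [T1 ->]].
apply: wp_seq.
apply: (wp_mono (@pick_spec n W HW s1 x d c0 _ _ _ _ _ _ _ _)); rewrite ?M1 ?C1 ?[reg s1 0]E1 //.
  by lia.
move=> s2 t2 w2 [E2 C2 M2 [/andP[cl cu] Hc] [T2 ->]]; set c := reg s2 8 in cl cu Hc.
have R21 : reg s2 1 = u by rewrite E2 // E1.
have R24 : reg s2 4 = reg s 4 by rewrite E2 // E1.
have R20 : reg s2 0 = n by rewrite E2 // E1.
have R25 : reg s2 5 = reg s 5 by rewrite E2 // E1.
have cr : 1 <= c <= D.+1 by have := HD u; lia.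
(* If only [S] was scanned, a neighbor outside [S] has a color of at most [K], below all
   candidates. *)
have free w : adj G u w -> col s w <> c.
  move=> a; case: xor => [Ex|[Ex Ec0]].
    by apply: Hc => //; rewrite Ex A.
  case: (boolP (w \in S)) => wS; first by apply: Hc => //; rewrite Ex AS.
  have : ~~ (reg s 4 + 2 < col s w).
    apply: contra wS => h; apply: ph => //.
    by apply: contraTneq a => ->; apply: (bounded_loop B).
  by lia.
have PC := proper_recolor (bounded_loop B u) pr cr pp free.
apply: wp_seq; apply: wp_col => //=; rewrite R21 C2.
have ra : (c != col s u) <= 1 by case: (_ != _).
have B0 := cell_bound (leqnn n) un'.
apply: wp_if; rewrite /= ?R20 ?R21 ?R24 ?M2 -?/(pos_of n (mem s) _ _) -?/c.
  by repeat split; lia.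
have high w : ~~ (reg s 4 + 2 < c) || (u \in S) -> reg s 4 + 2 < upd (col s) u c w ->
    w \in S.
  rewrite /upd val_eqE; case: eqP => [->|/eqP wu] h1 h2; last exact: ph.
  by rewrite h2 in h1.
case: ifP => Hif.
  have [Kc uS] : reg s 4 + 2 < c /\ u \notin S.
    move: Hif; rewrite -AS; case: (_ < c); rewrite /= ?mul0n ?mul1n //.
    by case: (pos_of _ _ _ _ == 0).
  apply: (wp_mono (@add_row_spec n W HW 0 1 _ _ _ _ _ _)); rewrite /= ?R20 ?R21 ?M2 //.
    by apply/eqP; rewrite -[_ == _]negbK AS.
  move=> s3 t3 w3 [E3 C3 R3 P3 [T3 ->]]; split; last by split; lia.
    exists (u |: S); split.
    + split; rewrite ?E3 /= ?R24 ?R25 //.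
      * by move=> y z; rewrite P3 // A eq_sym ord_neqn.
      * by move=> z; rewrite P3 // AS eqxx val_eqE in_setU1.
      (* The new color exceeds [K] and is at most [degree G u + 1], so the degree is at least
         [K]. *)
      * by apply: bounded_add => //; lia.
    + by rewrite C3 /= C2.
    + move=> w; rewrite C3 E3 /= C2 R24 /upd val_eqE in_setU1.
      by case: eqP => //= /eqP wu h; apply: ph.
  by rewrite E3 /= R24.
apply: wp_skip; split; rewrite /= ?R24 //; last by split; lia.
(* [u] may stay in [S] with a small color, since [S] only has to contain the vertices of large
   color. *)
exists S; split=> /=.
- by apply: (store_ext _ _ _ _ H); rewrite /= ?R20 ?R24 ?R25 ?M2.
- by rewrite C2.
- move=> w; rewrite R24 C2; apply: high.
  move: Hif; rewrite -AS; case: (_ < c); rewrite /= ?mul0n ?mul1n //.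
  by case: (pos_of _ _ _ _ == 0).
Qed.

Lemma insert_spec s G S u v :
  inv s G S -> reg s 1 = u -> reg s 2 = v -> u != v -> ~~ adj G u v ->
  #|[set u; v] |: G| <= M -> (forall w, degree ([set u; v] |: G) w <= D) ->
  wp W (insert_prog coloring_algorithm) s (fun s' t r =>
    [/\ (exists S', inv s' ([set u; v] |: G) S'),
        t <= 4000 * (reg s' 4 + 2) & r <= 1]).
Proof.
move=> [H [pr pp] ph] r1 r2 uv nuv GM HD.
have GM' : #|G| < M by rewrite cardsU1 nuv in GM.
apply: wp_seq; apply: (wp_mono (insert_edge_spec H r1 r2 uv nuv GM')).
move=> s1 t1 w1 [H1 [R11 R12] C1 K1 [T1 ->]].
have lu := bounded_loop (st_bounded H1).
have W1 : 1 < W by lia.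
apply: wp_if; rewrite /= R11 R12 C1; first by split=> //; case: (_ == _); lia.
(* A doubling of [K] only weakens this requirement. *)
have ph1 w : reg s1 4 + 2 < col s1 w -> w \in S.
  by rewrite C1 => h; apply: ph; lia.
case: (col s u =P col s v) => Ec /=.
  apply: (wp_mono (recolor_spec H1 R11 HD _)).
    split; rewrite ?C1 //.
    + move=> x y; rewrite adj_insert => /orP[/orP[]|a _ _]; last exact: pp.
        by case/andP=> /eqP ->; rewrite eqxx.
      by case/andP=> _ /eqP ->; rewrite eqxx.
    + by move=> w h _; apply: ph1; rewrite C1.
  move=> s2 t2 w2 [X E4 [T2 X2]]; split=> //.
  by rewrite E4; lia.
apply: wp_skip; split=> //; last by lia.
exists S; split=> //; rewrite C1; split=> // x y; rewrite adj_insert.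
case/orP=> [/orP[]|]; last exact: pp.
  by case/andP=> /eqP -> /eqP ->.
by case/andP=> /eqP -> /eqP -> E; apply: Ec.
Qed.

Lemma delete_spec s G S u v :
  inv s G S -> reg s 1 = u -> reg s 2 = v -> adj G u v ->
  (forall w, degree (G :\ [set u; v]) w <= D) ->
  wp W (delete_prog coloring_algorithm) s (fun s' t r =>
    [/\ (exists S', inv s' (G :\ [set u; v]) S'),
        t <= 4000 * (reg s' 4 + 2) & r <= 1]).
Proof.
set G' := G :\ _; move=> [H [pr pp] ph] r1 r2 auv HD.
have [r0 R A AS rm B KM Kn] := H; have cS := bounded_card B.
apply: wp_seq; apply: (wp_mono (delete_edge_spec H r1 r2 auv)).
move=> s1 t1 w1 [[R10 R1] A1 S1 [R14 R15 C1] [T1 ->]].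
have [_ Rr1] := R1.
have dS1 : deg_of (mem s1) n = #|S|.
  by rewrite (row_card (Rr1 _ (leqnn n))); apply: eq_card => w; rewrite !inE S1.
have dG1 w : deg_of (mem s1) w = degree G' w.
  rewrite (row_card (Rr1 _ (ltnW (ltn_ord w)))).
  by apply: eq_card => z; rewrite !inE A1.
apply: wp_seq; apply: (wp_mono (@scan_spec n W HW s1 (reg s 4 + 2) _ _ _ _)) => //.
- by rewrite R14.
- by lia.
rewrite dS1 => s2 t2 w2 [E2 C2 M2 R9 [T2 ->]].
have R20 : reg s2 0 = n by rewrite E2.
have pp' x y : adj G' x y -> col s x <> col s y.
  by rewrite adj_delete => /andP[_ /pp].
have W1 : 1 < W by lia.
have st s' S' : reg s' 0 = n -> reg s' 4 = reg s 4 -> reg s' 5 = #|G'| ->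
    rows_ok n (mem s') ->
    (forall x y, (pos_of n (mem s') x y != 0) = adj G' x y) ->
    (forall w, (pos_of n (mem s') n w != 0) = (w \in S')) ->
    bounded G' S' (reg s 4 + 2) -> store s' G' S'.
  by move=> h0 h4 h5 hr ha hs hb; split; rewrite ?h4.
apply: wp_if; rewrite /= R20; first by repeat split; lia.
case: R9 => [[-> none]|[w9 pw dw]].
  rewrite ltnn; apply: wp_skip; rewrite E2 // R14; split; [|lia|lia].
  exists S; split; rewrite ?C2 ?C1 //; last by move=> w; rewrite E2 // R14; apply: ph.
  apply: st; rewrite ?M2 ?E2 ?R14 ?R15 //.
  apply: bounded_delete_keep => // w wS; rewrite -/G' -dG1; apply: none => //.
  by rewrite S1.
rewrite w9; have [w Ew] : exists w, reg s2 9 = w by exists (Ordinal w9).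
have wS : w \in S by rewrite -S1 -Ew.
have dw' : degree G' w + 1 < reg s 4 + 2 by rewrite -dG1 -Ew.
have lw : ~~ adj G' w w by rewrite adj_delete negb_and (bounded_loop B) orbT.
apply: wp_seq.
apply: (wp_mono (@remove_row_spec n W HW 0 9 s2 _ _ _ _ _ _ _ _)); rewrite ?R20 ?M2 //.
move=> s3 t3 w3 [E3 C3 R3 P3 [T3 ->]].
have A3 x y : (pos_of n (mem s3) x y != 0) = adj G' x y.
  by rewrite P3 // A1 eq_sym ord_neqn.
have S3 x : (pos_of n (mem s3) n x != 0) = (x \in S :\ w).
  by rewrite P3 // S1 eqxx Ew val_eqE in_setD1.
have [_ Rr3] := R3.
have d3 : deg_of (mem s3) w = degree G' w.
  rewrite (row_card (Rr3 _ (ltnW (ltn_ord w)))).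
  by apply: eq_card => z; rewrite !inE A3.
have R39 : reg s3 9 = w by rewrite E3.
have dn := degree_le G' w.
apply: wp_seq; apply: wp_reg => //=; rewrite R39.
apply: wp_seq; apply: wp_reg => //=.
apply: wp_seq; apply: (wp_mono (@pick_spec n W HW _ w (degree G' w) 1 _ _ _ _ _ _ _ _)) => //=.
- by rewrite /upd /= E3.
- by lia.
- by rewrite C3 C2 C1 => z zn; have := pr (Ordinal zn) => /=; lia.
rewrite /upd /= => s4 t4 w4 [E4 C4 M4 [/andP[cl cu] Hc] [T4 ->]].
have R49 : reg s4 9 = w by rewrite E4 // R39.
have E6 c : c < 6 -> reg s4 c = reg s1 c.
  move=> c6; have [n6 n7 n8 n9] : [/\ c != 6, c != 7, c != 8 & c != 9] by split; lia.
  by rewrite E4 // (negbTE n8) (negbTE n6) E3 // E2.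
apply: wp_col => //=; rewrite R49 C4 C3 C2 C1 (E6 4) // R14.
rewrite C3 C2 C1 in Hc.
split; [|lia|by case: (_ != _)].
exists (S :\ w); split=> /=.
- apply: (@store_ext s4); rewrite //=.
  apply: st; rewrite ?M4 ?E6 ?R14 ?R15 //.
  exact: bounded_delete_remove.
- rewrite C4 C3 C2 C1; apply: proper_recolor => //.
  + by have := HD w; lia.
  + by move=> x y /pp'.
  + by move=> z a; apply: Hc => //; rewrite A3.
- move=> x; rewrite E6 // R14 C4 C3 C2 C1 in_setD1 /upd val_eqE.
  (* The new color of [w] is less than [K], so [w] may leave [S]. *)
  case: (eqVneq x w) => [->|xw] /=; first by lia.
  exact: ph.
Qed.

End Store.

(** * The square-root bound and sequences of operations *)

Lemma le_sqrt_edges t K M :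
  t <= 4000 * K -> K * K <= 4 * M ->
  Rle (INR t) (Rmult (INR 8000) (sqrt (INR M))).
Proof.
move=> tK KM.
have h1 : Rle (INR t) (Rmult (INR 4000) (INR K)) by rewrite -mult_INR; apply: le_INR; lia.
have h2 : Rle (Rmult (INR K) (INR K)) (Rmult (INR 4) (INR M)).
  by rewrite -!mult_INR; apply: le_INR; lia.
have e4 : sqrt (INR 4) = INR 2.
  by rewrite -(sqrt_square (INR 2)) -?mult_INR //; apply: pos_INR.
have h3 : Rle (INR K) (Rmult (INR 2) (sqrt (INR M))).
  rewrite -e4 -sqrt_mult; try exact: pos_INR.
  rewrite -(sqrt_square (INR K)); last exact: pos_INR.
  exact: sqrt_le_1_alt.
have -> : INR 8000 = Rmult (INR 4000) (INR 2) by rewrite -mult_INR.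
rewrite Rmult_assoc; apply: Rle_trans h1 _.
by apply: Rmult_le_compat_l h3; apply: pos_INR.
Qed.

Lemma maintains_inv n W M D (os : seq (op n)) s (G : graph n) S :
  100 * (n * n + n + 1) < W -> D <= n ->
  inv M D s G S -> valid_ops G os ->
  (forall G', G' \in G :: scanl (@apply_op n) G os ->
     #|G'| <= M /\ forall v, degree G' v <= D) ->
  maintains coloring_algorithm W D.+1 (Rmult (INR 8000) (sqrt (INR M))) (INR 3) s G os.
Proof.
move=> HW Dn; elim: os s G S => [|o os IH] s G S I; first by split=> //; case: I.
case: (I) => H Hp Hh /= /andP[vo vos] HG; split=> //.
have HG' G' : G' \in apply_op G o :: scanl (@apply_op n) (apply_op G o) os ->
    #|G'| <= M /\ forall v, degree G' v <= D.
  by move=> h; apply: HG; rewrite inE h orbT.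
have [GM GD] := HG' _ (mem_head _ _); have [GM0 _] := HG _ (mem_head _ _).
have I' r1 r2 : inv M D (set_reg (set_reg s 1 r1) 2 r2) G S.
  by split=> //; apply: (store_ext _ _ _ _ H).
case: o {HG} vo vos HG' GM GD => [u v|u v|v] /= vo vos HG' GM GD.
- case/andP: vo => uv nuv.
  have [//|//|s' [t [r [X [[S' J] T r1]]]]] :=
    insert_spec HW Dn (I' u v) _ _ uv nuv GM GD.
  exists s', t, r; split=> //; last exact: IH J vos HG'.
  split=> //; apply: le_sqrt_edges T _; have := st_KM (inv_store J).
  (* An update involves a graph with an edge, so the maximum with 1 disappears. *)
  have : 1 <= M by apply: leq_trans GM; rewrite cardsU1 -/(adj G u v) (negbTE nuv).
  by move/maxn_idPr ->.
- have [//|//|s' [t [r [X [[S' J] T r1]]]]] :=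
    delete_spec HW Dn (I' u v) _ _ vo GD.
  exists s', t, r; split=> //; last exact: IH J vos HG'.
  split=> //; apply: le_sqrt_edges T _; have := st_KM (inv_store J).
  have : 1 <= M by apply: leq_trans GM0; apply/card_gt0P; exists [set u; v].
  by move/maxn_idPr ->.
exists (set_reg (set_reg s 1 v) 3 (col s v)), 3, 0; split.
- exact: (@ExecSetReg W 3 (Col (Reg 1)) (set_reg s 1 v)).
- by split=> //; apply: Rle_refl.
apply: (IH _ _ S) => //; split=> //.
by apply: (store_ext _ _ _ _ H).
Qed.

Lemma init_inv n M D : 0 < n -> inv M D (init_state n) (set0 : graph n) set0.
Proof.
move=> n0; have noadj (u v : 'I_n) : adj (set0 : graph n) u v = false by rewrite /adj inE.
split=> //=; last by split=> // u v; rewrite noadj.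
split=> //=.
- by move=> w; rewrite inE.
- by rewrite cards0.
- split=> //.
  + by move=> u; rewrite noadj.
  + rewrite cards0 big1 // => v _; apply/eqP; rewrite cards_eq0; apply/eqP.
    by apply/setP => w; rewrite !inE noadj.
  + by rewrite cards0.
  + by rewrite /potential big_set0.
- by rewrite /upd /=; lia.
- by rewrite /upd /=; lia.
Qed.

(* Words have k * log2 (n + 2) bits.  The algorithm, the word-size constant k and
   the constants Cu, Cq hidden in the O-notation are uniform in n and in the
   sequence of operations. *)
Theorem theorem5 :
  exists (A : algorithm) (k : nat) (Cu Cq : R),
    forall (n : nat) (os : seq (op n)),
      valid_ops (set0 : graph n) os ->
      maintains A (n.+2 ^ k) (max_degree os).+1
        (Rmult Cu (sqrt (INR (max_edges os)))) Cq
        (init_state n) (set0 : graph n) os.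
Proof.
exists coloring_algorithm, 7, (INR 8000), (INR 3) => n os vos.
have [n0|n0] := posnP n.
  have noord (u : 'I_n) : False by case: u => i; rewrite n0.
  case: os vos => [_|[u v|u v|v] os _]; try by case: (noord u).
    by split=> //; split=> v; case: (noord v).
  by case: (noord v).
(* The exponent is 5 + 2: as [n] is positive, [n.+2 ^ 5] is at least 243, and [n.+2 ^ 2] dominates
   the quadratic polynomial. *)
have HW : 100 * (n * n + n + 1) < n.+2 ^ 7.
  have : 3 ^ 5 * n.+2 ^ 2 <= n.+2 ^ 5 * n.+2 ^ 2 by rewrite leq_mul2r leq_exp2r ?orbT.
  by rewrite -expnD; apply: leq_trans; rewrite -mulnn; nia.
apply: maintains_inv HW _ (init_inv _ _ n0) vos _.
  rewrite /max_degree; apply/bigmax_leqP_seq => G _ _; apply/bigmax_leqP => v _.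
  exact: degree_le.
move=> G HG; split; first by rewrite /max_edges (big_rem G) //= leq_maxl.
move=> v; rewrite /max_degree (big_rem G) //=; apply: leq_trans (leq_maxl _ _).
exact: leq_bigmax.
Qed.
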